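(* Let $p\ge 2$, let $n>2$ be an integer, let $p'=\frac{p}{p-1}$, and let $(X,\mu)$ be a measure space containing a measurable set of finite positive measure. The following two statements are equivalent. (1) For all $f_1,\dots,f_n\in L^p(X,\mu)$, not all zero, $$\Big\|\sum_{j=1}^n f_j\Big\|_p\le\Big(1+(n-1)\,\Gamma_p(f_1,\dots,f_n)^{\beta(n,p)}\Big)^{1/p'}\Big(\sum_{j=1}^n\|f_j\|_p^p\Big)^{1/p}.$$ (2) For all real $a_1,\dots,a_n\ge 0$ satisfying $\sum_{j=1}^n a_j^p=1$, $$\Big(\sum_{j=1}^n a_j\Big)^{p'}\le 1+(n-1)\Bigg[n\Big(\binom n2^{-1}\sum_{1\le i<j\le n}a_ia_j\Big)^{p/2}\Bigg]^{\beta(n,p)}.$$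
   Context: Definitions: $$\Gamma_p(f_1,\dots,f_n)=\frac{\Big\|\binom n2^{-1}\sum_{1\le j<k\le n}|f_jf_k|\Big\|_{p/2}^{p/2}}{n^{-1}\sum_{j=1}^n\|f_j\|_p^p},\qquad \beta(n,p)=\frac{\ln(n-1)-\ln(n-2)}{(\frac p2-1)\ln n+\ln(n-1)-\frac p2\ln(n-2)},$$ where $\|f\|_q=(\int_X|f|^q\,d\mu)^{1/q}$. *)

(* Defs.v *)
From mathcomp Require Import all_boot all_order all_algebra.
From mathcomp Require Import all_classical all_reals all_analysis.
From mathcomp Require Import complex.

Set Implicit Arguments.
Unset Strict Implicit.
Unset Printing Implicit Defensive.

Import Order.TTheory GRing.Theory Num.Theory.
Import ComplexField.

Local Open Scope classical_set_scope.
Local Open Scope ring_scope.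

Section Functionals.
Context {R : realType} {d : measure_display} {T : measurableType d}.
Variable mu : {measure set T -> \bar R}.

(* The scalars K stand for R or R[i], with md : K -> R the absolute value.  The
   library norm lives in \bar R; [fine] loses nothing below, since it is only
   applied to functions of finite norm (for f in L^p, the products f_j f_k have
   finite L^(p/2) norm by Hoelder, and sums are in L^p). *)
Definition LpNorm (K : Type) (md : K -> R) (q : R) (f : T -> K) : R :=
  fine (Lnorm mu q%:E (fun x => (md (f x))%:E)).

Definition Gamma (K : pzRingType) (md : K -> R) (p : R) (n : nat)
    (f : 'I_n -> T -> K) : R :=
  LpNorm Num.norm (p / 2)
    (fun x => 'C(n, 2)%:R^-1 *
      \sum_(j < n) \sum_(k < n | (j < k)%N) md (f j x * f k x)) `^ (p / 2)
  / (n%:R^-1 * \sum_(j < n) LpNorm md p (f j) `^ p).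

Definition beta_exp (n : nat) (p : R) : R :=
  (ln (n%:R - 1) - ln (n%:R - 2)) /
  ((p / 2 - 1) * ln n%:R + ln (n%:R - 1) - p / 2 * ln (n%:R - 2)).

Definition conj_exp (p : R) : R := p / (p - 1).

(* "Zero" is meant in L^p, that is, almost everywhere. *)
Definition sharp_triangle (K : pzRingType) (md : K -> R)
    (Lp : (T -> K) -> Prop) (n : nat) (p : R) : Prop :=
  forall f : 'I_n -> T -> K,
    (forall j, Lp (f j)) ->
    ~ (forall j, {ae mu, forall x, f j x = 0}) ->
    LpNorm md p (fun x => \sum_(j < n) f j x) <=
      (1 + (n%:R - 1) * Gamma md p f `^ beta_exp n p) `^ (conj_exp p)^-1
      * (\sum_(j < n) LpNorm md p (f j) `^ p) `^ p^-1.

Definition Lp_real (p : R) (f : T -> R) : Prop := f \in Lfun mu p%:E.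

Definition Lp_complex (p : R) (f : T -> R[i]) : Prop :=
  [/\ measurable_fun setT (fun x => complex.Re (f x)),
      measurable_fun setT (fun x => complex.Im (f x)) &
      (Lnorm mu p%:E (fun x => (Normc.normc (f x))%:E) < +oo)%E].

Definition sharp_triangle_real (n : nat) (p : R) : Prop :=
  sharp_triangle (K := R) Num.norm (Lp_real p) n p.

Definition sharp_triangle_complex (n : nat) (p : R) : Prop :=
  sharp_triangle (K := R[i]) (@Normc.normc R) (Lp_complex p) n p.

End Functionals.

Definition numerical_ineq {R : realType} (n : nat) (p : R) : Prop :=
  forall a : 'I_n -> R,
    (forall j, 0 <= a j) ->
    \sum_(j < n) a j `^ p = 1 ->
    (\sum_(j < n) a j) `^ conj_exp p <=
      1 + (n%:R - 1) *
        (n%:R * ('C(n, 2)%:R^-1 *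
           \sum_(i < n) \sum_(j < n | (i < j)%N) a i * a j) `^ (p / 2))
        `^ beta_exp n p.

(* Main.v *)
Require Import Defs.
From mathcomp Require Import all_boot all_order all_algebra.
From mathcomp Require Import all_classical all_reals all_analysis.
From mathcomp Require Import measurable_realfun complex ring lra zify.

Import Order.TTheory GRing.Theory Num.Theory.
Import numFieldNormedType.Exports.

Local Open Scope classical_set_scope.
Local Open Scope ring_scope.

(** From numbers to functions.  Put a_j = |f_j(x)|, s = sum_j a_j^p, let e be the mean
    of the products a_j a_k over the pairs j < k, and u = n e^(p/2).  Applied
    to the a_j / s^(1/p), the numerical inequality becomes the pointwise bound
      |sum_j f_j(x)|^p <= s Phi(u / s),   Phi(t) = (1 + (n-1) t^beta)^(p-1),
    ([numerical_ineq_homogeneous]), where 0 <= u <= s by comparison of e with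
    the square of the arithmetic mean and then by the power mean inequality
    ([pair_mean_powR_le]).  If Phi is concave on [0, 1], then
    (s, u) |-> s Phi(u / s) is concave and homogeneous of degree 1, and Jensen's
    inequality gives
      int |sum_j f_j|^p <= S Phi(U / S),   S = int s,  U = int u
    ([Rintegral_perspective_le]).  Since U / S is Gamma_p and (p-1)/p = 1/p',
    the p-th root of this is the claim; nothing depends on the scalars beyond the
    triangle inequality and the multiplicativity of the absolute value, so the
    real and the complex case are one statement
    ([sharp_triangle_of_numerical]).

    The concavity is where the value of beta enters.  The sign of Phi'' on
    (0, 1] is decided at t = 1, where Phi'' <= 0 reads
      beta (1 + (p - 2) (n - 1) / n) <= 1.
    For p > 2, inserting the definition of beta, this becomes
      2 (n - 1) ln ((n-1)/(n-2)) <= n ln (n/(n-2)),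
    which is convexity of x ln x at n - 2, n - 1, n ([ln_ratio_ge],
    [beta_exp_le]).  Only tangent lines are used afterwards, so concavity is
    recorded as Phi(t) <= Phi(t0) + Phi'(t0) (t - t0) ([sharp_factor_le_tangent]).

    From functions to numbers.  For multiples a_j 1_A of one indicator, with A
    of finite positive measure, every integral is a multiple of mu(A), which
    cancels ([numerical_of_sharp_triangle]). *)

(** * The exponent beta *)

Section Exponent.
Context {R : realType}.

Lemma ln_ge_1subV (x : R) : 0 < x -> 1 - x^-1 <= ln x.
Proof.
move=> x0; have := @le_ln1Dx R (x^-1 - 1).
have -> : 1 + (x^-1 - 1) = x^-1 by ring.
rewrite lnV ?posrE// => h.
have : - ln x <= x^-1 - 1 by apply: h; rewrite ltrBDl subrr invr_gt0.
lra.
Qed.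

(** Convexity of t ln t at x - 2, x - 1, x.  The bound ln t >= 1 - 1/t gives
    x ln (x/(x-1)) >= 1 >= (x-2) ln ((x-1)/(x-2)), which is the claim after
    collecting logarithms. *)
Lemma ln_ratio_ge (x : R) : 2 < x ->
  2 * (x - 1) * (ln (x - 1) - ln (x - 2)) <= x * (ln x - ln (x - 2)).
Proof.
move=> x2.
have hx : 1 <= x * (ln x - ln (x - 1)).
  have := @ln_ge_1subV (x / (x - 1)).
  rewrite ln_div ?posrE; [|lra|lra] => /(_ ltac:(apply: divr_gt0; lra)) h.
  have := ler_wpM2l (_ : 0 <= x) h; rewrite invf_div mulrBr mulr1 => /(_ ltac:(lra)).
  rewrite mulrCA divff ?mulr1; lra.
have hx2 : (x - 2) * (ln (x - 1) - ln (x - 2)) <= 1.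
  have := @ln_ge_1subV ((x - 2) / (x - 1)).
  rewrite ln_div ?posrE; [|lra|lra] => /(_ ltac:(apply: divr_gt0; lra)) h.
  have := ler_wpM2l (_ : 0 <= x - 2) h; rewrite invf_div mulrBr mulr1 => /(_ ltac:(lra)).
  rewrite mulrCA divff ?mulr1; lra.
lra.
Qed.

End Exponent.

Section BetaExp.
Context {R : realType}.
Variables (n : nat) (p : R).
Hypotheses (hp : 2 <= p) (hn : (2 < n)%N).

Local Notation N := (n%:R : R).
Local Notation b := (beta_exp n p).

Lemma natr_gt2 : 2 < N.
Proof. by rewrite ltr_nat. Qed.

Lemma beta_exp_gt0 : 0 < b.
Proof.
have p2 := hp; have N2 := natr_gt2.
have h1 : ln (N - 2) < ln (N - 1) by rewrite ltr_ln ?posrE; lra.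
have h2 : ln (N - 2) <= ln N by rewrite ler_ln ?posrE; lra.
rewrite /beta_exp divr_gt0//; first lra.
have : 0 <= (p / 2 - 1) * (ln N - ln (N - 2)) by rewrite mulr_ge0; lra.
lra.
Qed.

(** Writing 1/beta = 1 + (p/2 - 1) ln (n/(n-2)) / ln ((n-1)/(n-2)), this is
    [ln_ratio_ge] at n; it is the concavity condition for [sharp_factor]. *)
Lemma beta_exp_le : b * (1 + (p - 2) * ((N - 1) / N)) <= 1.
Proof.
have p2 := hp; have N2 := natr_gt2.
have h1 : ln (N - 2) < ln (N - 1) by rewrite ltr_ln ?posrE; lra.
have h2 : ln (N - 2) <= ln N by rewrite ler_ln ?posrE; lra.
have h3 : 0 <= (p / 2 - 1) * (ln N - ln (N - 2)) by rewrite mulr_ge0; lra.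
rewrite /beta_exp mulrAC ler_pdivrMr ?mul1r; last lra.
have h4 : (p / 2 - 1) * (2 * ((N - 1) / N) * (ln (N - 1) - ln (N - 2))) <=
    (p / 2 - 1) * (ln N - ln (N - 2)).
  apply: ler_wpM2l; first lra.
  have -> : 2 * ((N - 1) / N) * (ln (N - 1) - ln (N - 2)) =
      2 * (N - 1) * (ln (N - 1) - ln (N - 2)) / N by ring.
  rewrite ler_pdivrMr; last lra.
  by rewrite [leRHS]mulrC ln_ratio_ge.
lra.
Qed.

End BetaExp.

(** * Concavity of the sharpening factor *)

Section Concavity.
Context {R : realType}.

(** The function ln (1 + c v) grows slower than c / (1 + c) times ln v on (0, 1],
    its derivative in ln v being c v / (1 + c v).  Instead of differentiating,
    the inverse of the left-hand side is written as a convex combination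
    of 1 and x / y, and weighted AM-GM is applied. *)
Lemma powR_ratio_le (c x y : R) : 0 < c -> 0 < x -> x <= y -> y <= 1 ->
  (1 + c * y) / (1 + c * x) <= (y / x) `^ (c / (1 + c)).
Proof.
move=> c0 x0 xy y1; have y0 : 0 < y by lra.
have cx : 0 < c * x by rewrite mulr_gt0.
have cy : 0 < c * y by rewrite mulr_gt0.
have yx1 : 1 <= y / x by rewrite ler_pdivlMr; lra.
pose k := c * y / (1 + c * y).
have k1 : k <= c / (1 + c).
  have : c * y <= c by rewrite ger_pMr.
  rewrite /k ler_pdivrMr; last lra.
  rewrite mulrAC ler_pdivlMr; lra.
have k0 : 0 < k by rewrite divr_gt0; lra.
have kl1 : k < 1 by rewrite /k ltr_pdivrMr; lra.
apply: (@le_trans _ _ ((y / x) `^ k)); last exact: ler_powR.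
have xy0 : 0 < x / y by rewrite divr_gt0.
(* Young's inequality with exponents 1/k and 1/(1-k) is weighted AM-GM. *)
have := @conjugate_powR R ((x / y) `^ k) 1 k^-1 (1 - k)^-1.
rewrite !invrK mulr1 powR1 mul1r -powRrM divff ?powRr1; [|lra|lra].
rewrite !invr_gt0 => /(_ (powR_ge0 _ _) ler01) h.
have {}h : (x / y) `^ k <= x / y * k + (1 - k) by apply: h; lra.
have e : x / y * k + (1 - k) = (1 + c * x) / (1 + c * y).
  by rewrite /k; field; apply/andP; split; lra.
have -> : (y / x) `^ k = ((x / y) `^ k)^-1.
  by rewrite -powRN -mulN1r (powRrM _ (-1)) powR_inv1 ?invf_div// ltW.
rewrite -[leLHS]invf_div lef_pV2 ?posrE ?powR_gt0//; last by rewrite divr_gt0; lra.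
by rewrite -e.
Qed.

(* In the application c = n - 1 and b = beta; hpcb says that the second
   derivative of (1 + c t^b)^(p-1) is nonpositive at t = 1. *)
Variables (p c b : R).
Hypotheses (hp : 2 <= p) (hc : 0 < c) (hb : 0 < b)
  (hpcb : b * (1 + (p - 2) * (c / (1 + c))) <= 1).

Definition sharp_factor (t : R) := (1 + c * t `^ b) `^ (p - 1).

Definition sharp_factor_deriv (t : R) :=
  (p - 1) * (c * b) * (t `^ (b - 1) * (1 + c * t `^ b) `^ (p - 2)).

Lemma sharp_factor_base_ge1 (t : R) : 1 <= 1 + c * t `^ b.
Proof.
have p2 := hp; have c0 := hc.
have : 0 <= c * t `^ b by rewrite mulr_ge0 ?powR_ge0; lra.
lra.
Qed.

Lemma sharp_factor_deriv_ge0 (t : R) : 0 <= sharp_factor_deriv t.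
Proof.
have p2 := hp; have c0 := hc; have b0 := hb.
rewrite /sharp_factor_deriv !mulr_ge0 ?powR_ge0 //; lra.
Qed.

(** From x to y the factor t^(b-1) is multiplied by (y/x)^(b-1), and by
    [powR_ratio_le] at x^b, y^b the other factor grows at most by
    (y/x)^(b (p-2) c/(1+c)).  The sum of the two exponents is nonpositive by
    hpcb. *)
Lemma sharp_factor_deriv_nincr (x y : R) : 0 < x -> x <= y -> y <= 1 ->
  sharp_factor_deriv y <= sharp_factor_deriv x.
Proof.
move=> x0 xy y1; have c0 := hc; have b0 := hb; have y0 := lt_le_trans x0 xy.
have p1 : 0 <= p - 1 by rewrite subr_ge0 (le_trans _ hp)// ler1n.
apply: ler_wpM2l; first by rewrite !mulr_ge0// ltW.
have Bx := sharp_factor_base_ge1 x; have By := sharp_factor_base_ge1 y.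
have r1 : 1 <= y / x by rewrite ler_pdivlMr ?mul1r.
have h1 : (1 + c * y `^ b) / (1 + c * x `^ b) <=
    (y / x) `^ (b * (c / (1 + c))).
  have : (1 + c * y `^ b) / (1 + c * x `^ b) <=
      (y `^ b / x `^ b) `^ (c / (1 + c)).
    apply: powR_ratio_le; rewrite ?powR_gt0//.
    - by apply: ge0_ler_powR; rewrite ?nnegrE; lra.
    - rewrite -[leRHS](_ : 1 `^ b = 1); last by rewrite powR1.
      apply: ge0_ler_powR; rewrite ?nnegrE; lra.
  move/le_trans; apply.
  have -> : y `^ b / x `^ b = (y / x) `^ b.
    by rewrite -[in RHS](powR_inv1 (ltW x0)) powRM ?powR_ge0 ?ltW// -powRrM mulN1r powRN.
  by rewrite -powRrM.
set Bx1 := 1 + _ * x `^ b in Bx h1 *; set By1 := 1 + _ * y `^ b in By h1 *.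
have e1 : By1 `^ (p - 2) <= (y / x) `^ (b * (c / (1 + c)) * (p - 2)) * Bx1 `^ (p - 2).
  have Bx0 : 0 < Bx1 := lt_le_trans ltr01 Bx.
  have BB0 : 0 <= By1 / Bx1 by rewrite divr_ge0 ?ltW// (lt_le_trans ltr01 By).
  have e0 : By1 = By1 / Bx1 * Bx1 by rewrite divfK// gt_eqF.
  rewrite [X in X `^ _ <= _]e0 (powRM _ BB0 (ltW Bx0)).
  apply: ler_wpM2r; rewrite ?powR_ge0// powRrM.
  by apply: ge0_ler_powR; rewrite ?nnegrE ?powR_ge0 ?subr_ge0.
have e2 : y `^ (b - 1) = (y / x) `^ (b - 1) * x `^ (b - 1).
  by rewrite -powRM ?divfK ?gt_eqF// ?divr_ge0 ?ltW.
apply: (le_trans (ler_wpM2l (powR_ge0 _ _) e1)).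
rewrite e2 mulrACA -powRD; last by rewrite (gt_eqF (_ : 0 < y / x)) ?implybT// divr_gt0.
rewrite ler_piMl ?mulr_ge0 ?powR_ge0// -[leRHS](powRr0 (y / x)) ler_powR//.
have -> : b - 1 + b * (c / (1 + c)) * (p - 2) =
    b * (1 + (p - 2) * (c / (1 + c))) - 1 by ring.
by rewrite subr_le0.
Qed.

Lemma is_derive_powR (a x : R) : 0 < x ->
  is_derive x (1 : R) (fun t : R => t `^ a) (a * x `^ (a - 1)).
Proof.
move=> x0; have xin : x \in `]0, +oo[ by rewrite in_itv/= x0.
apply: DeriveDef; first exact: derivable_powR.
by rewrite -derive1E powR_derive1.
Qed.

Lemma is_derive_sharp_factor (x : R) : 0 < x ->
  is_derive x (1 : R) sharp_factor (sharp_factor_deriv x).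
Proof.
move=> x0.
have h1 := is_derive_powR b x x0.
have B0 : 0 < 1 + c * x `^ b by have := sharp_factor_base_ge1 x; lra.
have h2 : is_derive x (1 : R) (fun t : R => 1 + c * t `^ b)
    (c * (b * x `^ (b - 1))).
  have := is_deriveD (is_derive_cst (1 : R) x (1 : R)) (is_deriveZ c h1).
  by rewrite add0r.
have h3 := is_derive_powR (p - 1) _ B0.
have := @is_derive1_comp R (fun t : R => t `^ (p - 1)) (fun t => 1 + c * t `^ b) x _ _ h3 h2.
rewrite /sharp_factor /sharp_factor_deriv.
have -> : p - 1 - 1 = p - 2 by ring.
by congr is_derive; ring.
Qed.

Lemma sharp_factor_le_tangent_pos (t0 t : R) : 0 < t0 <= 1 -> 0 < t <= 1 ->
  sharp_factor t <= sharp_factor t0 + sharp_factor_deriv t0 * (t - t0).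
Proof.
move=> /andP[t00 t01] /andP[tp t1].
have MV (x y : R) : 0 < x -> x < y -> exists2 z, z \in `]x, y[ &
    sharp_factor y - sharp_factor x = sharp_factor_deriv z * (y - x).
  move=> x0 xy; apply: MVT => //.
    by move=> z /[!in_itv]/= /andP[xz _]; apply: is_derive_sharp_factor; exact: lt_trans xz.
  apply: derivable_within_continuous => z /[!in_itv]/= /andP[xz _].
  by have [] := is_derive_sharp_factor z (lt_le_trans x0 xz).
case: (ltgtP t t0) => [tt|tt|->]; last by rewrite subrr mulr0 addr0.
- have [z /[!in_itv]/= /andP[z1 z2] e] := MV _ _ tp tt.
  have h := sharp_factor_deriv_nincr z t0 (lt_trans tp z1) (ltW z2) t01.
  rewrite -lerBlDl -opprB -[t - t0]opprB mulrN lerN2 e.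
  by apply: ler_wpM2r => //; rewrite subr_ge0 ltW.
- have [z /[!in_itv]/= /andP[z1 z2] e] := MV _ _ t00 tt.
  have h := sharp_factor_deriv_nincr t0 z t00 (ltW z1) (le_trans (ltW z2) t1).
  rewrite -lerBlDl e.
  by apply: ler_wpM2r => //; rewrite subr_ge0 ltW.
Qed.

(** At t = 0 the derivative may blow up, so the tangent bound is passed to the
    limit from small d > 0, using that the factor is nondecreasing. *)
Lemma sharp_factor_le_tangent (t0 t : R) : 0 < t0 <= 1 -> 0 <= t <= 1 ->
  sharp_factor t <= sharp_factor t0 + sharp_factor_deriv t0 * (t - t0).
Proof.
move=> t0p /andP[]; rewrite le_eqVlt => /predU1P[<- _|t1 t2]; last first.
  by apply: sharp_factor_le_tangent_pos; rewrite ?t1.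
apply/ler_addgt0Pr => e e0.
have D0 := sharp_factor_deriv_ge0 t0; pose d := Num.min 1 (e / (1 + sharp_factor_deriv t0)).
have D1 : 0 < 1 + sharp_factor_deriv t0 := lt_le_trans ltr01 (ler_wpDr D0 (lexx 1)).
have d0 : 0 < d by rewrite lt_min ltr01 divr_gt0.
have d1 : d <= 1 by rewrite ge_min lexx.
have de : d * (1 + sharp_factor_deriv t0) <= e by rewrite -ler_pdivlMr// ge_min lexx orbT.
have le_phi0 : sharp_factor 0 <= sharp_factor d.
  have p1 : 0 <= p - 1 by rewrite subr_ge0 (le_trans _ hp)// ler1n.
  have B0 := sharp_factor_base_ge1 0; have Bd := sharp_factor_base_ge1 d.
  apply: (ge0_ler_powR p1); rewrite ?nnegrE ?(le_trans ler01)//.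
  by rewrite powR0 ?gt_eqF// lerD2l mulr0 mulr_ge0 ?powR_ge0// ltW.
have le_phid := sharp_factor_le_tangent_pos t0 d t0p (introT andP (conj d0 d1)).
apply: (le_trans le_phi0); apply: (le_trans le_phid).
rewrite -[leRHS]addrA lerD2l sub0r mulrBr mulrN [leRHS]addrC lerD2r (le_trans _ de)//.
by rewrite mulrDr mulr1 mulrC ler_wpDl// ltW.
Qed.

End Concavity.

(** * Power means and pair means *)

Section Means.
Context {R : realType}.

(** With m the arithmetic mean, sum Young's inequality
    a_j m^(p-1) <= a_j^p / p + m^p (p-1) / p over j: the left-hand side becomes
    n m^p, and n m^p / p remains after cancellation. *)
Lemma powR_mean_le (n : nat) (p : R) (a : 'I_n -> R) : (0 < n)%N -> 1 < p ->
  (forall j, 0 <= a j) ->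
  n%:R * ((\sum_(j < n) a j) / n%:R) `^ p <= \sum_(j < n) a j `^ p.
Proof.
move=> n0 p1 a0; have N0 : (0 : R) < n%:R by rewrite ltr0n.
have p0 : 0 < p by lra.
set A := \sum_(j < n) a j; set m := A / n%:R; set S := \sum_(j < n) _.
have m0 : 0 <= m by rewrite divr_ge0 ?ler0n// sumr_ge0.
have young j : a j * m `^ (p - 1) <= a j `^ p / p + m `^ p * ((p - 1) / p).
  have := @conjugate_powR R (a j) (m `^ (p - 1)) p (p / (p - 1)) (a0 j) (powR_ge0 _ _) p0.
  rewrite -powRrM invf_div (mulrC (p - 1) (p / (p - 1))) divfK; last by rewrite gt_eqF; lra.
  apply; first by rewrite divr_gt0; lra.
  by rewrite mulrBl mul1r divff ?gt_eqF// addrC subrK.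
have : \sum_(j < n) (a j * m `^ (p - 1)) <=
    \sum_(j < n) (a j `^ p / p + m `^ p * ((p - 1) / p)) by apply: ler_sum.
rewrite -mulr_suml big_split/= -mulr_suml -/S -/A sumr_const card_ord -(mulr_natl (_ * _)).
have -> : A = n%:R * m by rewrite mulrC divfK// gt_eqF.
rewrite -mulrA mulr_powRB1// => h.
have : p^-1 * (n%:R * m `^ p) <= p^-1 * S.
  have -> : p^-1 * (n%:R * m `^ p) =
      n%:R * m `^ p - n%:R * (m `^ p * ((p - 1) / p)).
    by field; rewrite gt_eqF.
  by rewrite lerBlDr (mulrC p^-1).
by rewrite ler_pM2l// invr_gt0.
Qed.

Lemma sum_pairs (n : nat) (a : 'I_n -> R) :
  (\sum_(j < n) a j) ^+ 2 = \sum_(j < n) a j ^+ 2 +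
    2 * \sum_(i < n) \sum_(j < n | (i < j)%N) a i * a j.
Proof.
have e : \sum_(i < n) \sum_(j < n | (j < i)%N) a i * a j =
    \sum_(i < n) \sum_(j < n | (i < j)%N) a i * a j.
  rewrite (exchange_big_dep predT)//=.
  by apply: eq_bigr => i _; apply: eq_bigr => j _; rewrite mulrC.
rewrite expr2 mulr_suml mulr_natl mulr2n -{2}e addrA -!big_split/=.
apply: eq_bigr => i _.
rewrite mulr_sumr (bigD1 i)//= -expr2 -addrA; congr (_ + _).
rewrite (bigID (fun j : 'I_n => (i < j)%N))/=; congr (_ + _); apply: eq_bigl => j.
  by rewrite neq_ltn/=; lia.
by rewrite neq_ltn/=; lia.
Qed.

Definition pair_mean (n : nat) (a : 'I_n -> R) : R :=
  'C(n, 2)%:R^-1 * \sum_(i < n) \sum_(j < n | (i < j)%N) a i * a j.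

Lemma pair_mean_ge0 (n : nat) (a : 'I_n -> R) : (forall j, 0 <= a j) ->
  0 <= pair_mean n a.
Proof.
move=> a0; rewrite mulr_ge0 ?invr_ge0 ?ler0n// sumr_ge0// => i _.
by rewrite sumr_ge0// => j _; rewrite mulr_ge0.
Qed.

(** By [sum_pairs], twice the sum over pairs is the square of the sum minus the
    sum of squares, and the latter is at least the square of the sum divided
    by n ([powR_mean_le] at exponent 2). *)
Lemma pair_mean_le (n : nat) (a : 'I_n -> R) : (1 < n)%N ->
  (forall j, 0 <= a j) -> pair_mean n a <= ((\sum_(j < n) a j) / n%:R) ^+ 2.
Proof.
move=> n1 a0; have N1 : (1 : R) < n%:R by rewrite ltr1n.
have N0 : (0 : R) < n%:R by lra.
have C2 : 'C(n, 2)%:R = n%:R * (n%:R - 1) / 2 :> R.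
  have : ('C(n, 2) * 2)%:R = (n * n.-1)%:R :> R.
    by congr (_%:R); rewrite -[2%N in LHS]/(2`!) bin_ffact ffactnS ffactn1.
  rewrite !natrM -subn1 natrB ?(ltnW n1)// => <-.
  by rewrite mulfK// pnatr_eq0.
have h := @powR_mean_le n 2 a (ltnW n1) ltac:(lra) a0.
rewrite !powR_mulrn ?divr_ge0 ?sumr_ge0 ?ler0n// in h.
have {}h : n%:R * ((\sum_(j < n) a j) / n%:R) ^+ 2 <= \sum_(j < n) a j ^+ 2.
  by rewrite (le_trans h)// ler_sum// => j _; rewrite powR_mulrn.
have := sum_pairs n a; rewrite /pair_mean C2 => e.
set P := \sum_(i < n) _ in e *; set A := \sum_(j < n) a j in e h *.
set Q := \sum_(j < n) _ in e h *.
rewrite ler_pdivrMl; last by rewrite divr_gt0 ?mulr_gt0//; lra.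
have e2 : n%:R * (n%:R - 1) / 2 * (A / n%:R) ^+ 2 =
   (A ^+ 2 - n%:R * (A / n%:R) ^+ 2) / 2 by field; lra.
by rewrite e2; lra.
Qed.

(** The pointwise form of Gamma_p <= 1: it keeps the argument of the sharpening
    factor in [0, 1], where the factor is concave. *)
Lemma pair_mean_powR_le (n : nat) (p : R) (a : 'I_n -> R) : (1 < n)%N -> 1 < p ->
  (forall j, 0 <= a j) ->
  n%:R * pair_mean n a `^ (p / 2) <= \sum_(j < n) a j `^ p.
Proof.
move=> n1 p1 a0; apply: le_trans (powR_mean_le n p a (ltnW n1) p1 a0).
rewrite ler_wpM2l ?ler0n//.
have m0 : 0 <= (\sum_(j < n) a j) / n%:R by rewrite divr_ge0 ?sumr_ge0.
have -> : ((\sum_(j < n) a j) / n%:R) `^ p = (((\sum_(j < n) a j) / n%:R) ^+ 2) `^ (p / 2).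
  by rewrite -powR_mulrn// -powRrM; congr (_ `^ _); field.
apply: ge0_ler_powR; rewrite ?nnegrE ?pair_mean_ge0 ?exprn_ge0 ?pair_mean_le//; lra.
Qed.

End Means.

(** * The numerical inequality without normalization *)

Section Homogeneous.
Context {R : realType}.

Lemma numerical_ineq_homogeneous (n : nat) (p : R) (a : 'I_n -> R) :
  1 < p -> @numerical_ineq R n p -> (forall j, 0 <= a j) ->
  (\sum_(j < n) a j) `^ p <= (\sum_(j < n) a j `^ p) *
    sharp_factor p (n%:R - 1) (beta_exp n p)
      (n%:R * pair_mean n a `^ (p / 2) / \sum_(j < n) a j `^ p).
Proof.
move=> p1 num a0; set s := \sum_(j < n) a j `^ p.
have p0 : 0 < p by lra.
have s0 : 0 <= s by rewrite sumr_ge0// => j _; rewrite powR_ge0.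
have [s00|sn0] := eqVneq s 0.
  have aj j : a j = 0.
    apply: (@powR_eq0_eq0 _ _ p); apply/eqP.
    move/eqP: s00; rewrite psumr_eq0 => [/allP/(_ j)|i _]; last exact: powR_ge0.
    by rewrite mem_index_enum => /(_ isT).
  by rewrite s00 mul0r big1 ?powR0 ?gt_eqF.
have sp : 0 < s by rewrite lt_neqAle eq_sym sn0.
pose k := s `^ p^-1.
have k0 : 0 < k by rewrite powR_gt0.
have kp : k `^ p = s by rewrite -powRrM mulVf ?gt_eqF// powRr1.
have := num (fun j => a j / k).
have -> : \sum_(j < n) (a j / k) `^ p = 1.
  transitivity (\sum_(j < n) a j `^ p / s); last by rewrite -mulr_suml divff.
  apply: eq_bigr => j _; rewrite powRM ?invr_ge0 ?(ltW k0)//.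
  by rewrite -(powR_inv1 (ltW k0)) powRAC kp powR_inv1.
rewrite -mulr_suml => /(_ (fun j => divr_ge0 (a0 j) (ltW k0)) erefl).
set A := \sum_(j < n) a j => h.
have A0 : 0 <= A by rewrite sumr_ge0.
have B0 : 0 <= A / k by rewrite divr_ge0// ltW.
have {}h : (A / k) `^ p <= sharp_factor p (n%:R - 1) (beta_exp n p)
    (n%:R * pair_mean n (fun j => a j / k) `^ (p / 2)).
  have -> : (A / k) `^ p = ((A / k) `^ conj_exp p) `^ (p - 1).
    by rewrite -powRrM /conj_exp divfK// gt_eqF//; lra.
  apply: ge0_ler_powR; rewrite ?nnegrE ?powR_ge0//; first lra.
  exact: le_trans (powR_ge0 _ _) h.
have e1 : pair_mean n (fun j => a j / k) = pair_mean n a / k ^+ 2.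
  rewrite /pair_mean -mulrA; congr (_ * _); rewrite mulr_suml.
  apply: eq_bigr => i _; rewrite mulr_suml; apply: eq_bigr => j _.
  by field; rewrite gt_eqF.
have e2 : n%:R * pair_mean n (fun j => a j / k) `^ (p / 2) =
    n%:R * pair_mean n a `^ (p / 2) / s.
  rewrite e1 powRM ?pair_mean_ge0 ?invr_ge0 ?exprn_ge0 ?(ltW k0)//.
  rewrite mulrA; congr (_ * _).
  rewrite -(powR_mulrn 2 (ltW k0)) -powR_inv1 ?powR_ge0// -!powRrM.
  have -> : 2 * (-1 * (p / 2)) = p * -1 by field.
  by rewrite mulrA mulVf ?gt_eqF// mul1r powR_inv1.
rewrite e2 in h.
rewrite mulrC -ler_pdivrMr// (le_trans _ h)//.
rewrite powRM ?invr_ge0 ?(ltW k0)//.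
by rewrite -(powR_inv1 (ltW k0)) powRAC kp powR_inv1.
Qed.

End Homogeneous.

(** * Jensen's inequality for a perspective function *)

Section Perspective.
Context {R : realType} {d : measure_display} {T : measurableType d}.
Variable mu : {measure set T -> \bar R}.

(** If the ratio t0 of the integrals of u and s is positive, the tangent of F
    at t0 bounds g pointwise by a linear combination of s and u, whose integral
    is the right-hand side.  At t0 = 0 there need not be a tangent, but then
    u = 0 almost everywhere, hence g <= F(0) s almost everywhere. *)
Lemma Rintegral_perspective_le (F D : R -> R) (g s u : T -> R) :
  (forall t0 t, 0 < t0 <= 1 -> 0 <= t <= 1 -> F t <= F t0 + D t0 * (t - t0)) ->
  0 <= F 0 ->
  measurable_fun setT g ->
  mu.-integrable setT (EFin \o s) -> mu.-integrable setT (EFin \o u) ->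
  (forall x, 0 <= g x) -> (forall x, 0 <= u x <= s x) ->
  (forall x, g x <= s x * F (u x / s x)) ->
  (\int[mu]_x g x <= (\int[mu]_x s x) * F ((\int[mu]_x u x) / \int[mu]_x s x))%R.
Proof.
move=> tangent F0 mg intS intU g0 us gF.
have mT : d.-measurable [set: T] := measurableT.
have u0 x : 0 <= u x by have /andP[] := us x.
have s0 x : 0 <= s x by have /andP[ux] := us x; exact: le_trans.
have tangent_g t0 x : 0 < t0 <= 1 -> g x <= (F t0 - D t0 * t0) * s x + D t0 * u x.
  move=> t0p; apply: (le_trans (gF x)).
  have [ux usx] := andP (us x).
  have [sx0|sxn0] := eqVneq (s x) 0.
    have -> : u x = 0 by apply/eqP; rewrite eq_le ux -sx0 usx.
    by rewrite sx0 !mulr0 mul0r addr0.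
  have sxp : 0 < s x by rewrite lt_neqAle eq_sym sxn0 s0.
  have t01 : 0 <= u x / s x <= 1 by rewrite divr_ge0// ler_pdivrMr ?mul1r.
  rewrite (le_trans (ler_wpM2l (s0 x) (tangent _ _ t0p t01)))//.
  rewrite le_eqVlt; apply/orP; left; apply/eqP; field.
  exact: sxn0.
have intZ a (h : T -> R) : mu.-integrable setT (EFin \o h) ->
    mu.-integrable setT (EFin \o (fun x => a * h x)).
  by move=> inth; exact: (integrableZl mT a inth).
have int_line a b : mu.-integrable setT (EFin \o (fun x => a * s x + b * u x)).
  exact: (integrableD mT (integrableZl mT a intS) (integrableZl mT b intU)).
(* The tangent at 1 gives an integrable bound of g. *)
have intG : mu.-integrable setT (EFin \o g).
  apply: (le_integrable _ _ _ (int_line (F 1 - D 1 * 1) (D 1))) => //.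
    exact/measurable_EFinP.
  move=> x _ /=; rewrite lee_fin ger0_norm//.
  by apply: le_trans (ler_norm _); apply: tangent_g; rewrite ltr01 lexx.
have U0 : 0 <= \int[mu]_x u x by apply: Rintegral_ge0.
have US : \int[mu]_x u x <= \int[mu]_x s x.
  by apply: le_Rintegral => // x _; have /andP[] := us x.
set S := \int[mu]_x s x in US *; set U := \int[mu]_x u x in U0 US *.
have [U00|Un0] := eqVneq U 0; last first.
  have Up : 0 < U by rewrite lt_neqAle eq_sym Un0.
  have Sp : 0 < S := lt_le_trans Up US.
  have t0p : 0 < U / S <= 1 by rewrite divr_gt0// ler_pdivrMr ?mul1r.
  pose a := F (U / S) - D (U / S) * (U / S); pose b := D (U / S).
  have : \int[mu]_x g x <= \int[mu]_x (a * s x + b * u x).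
    by apply: le_Rintegral => // x _; exact: tangent_g.
  move/le_trans; apply.
  rewrite RintegralD//; [|exact: intZ|exact: intZ].
  rewrite !RintegralZl// -/S -/U /a /b.
  rewrite le_eqVlt; apply/orP; left; apply/eqP; field.
  by rewrite gt_eqF.
rewrite U00 mul0r.
have u_ae0 : ae_eq mu setT (EFin \o u) (cst 0%E).
  apply/(ae_eq_integral_abs mu mT (measurable_int mu intU)).
  under eq_integral => x _ do rewrite /= ger0_norm//.
  rewrite -[LHS]fineK; last exact: integrable_fin_num.
  by rewrite -/(Rintegral _ _ _) -/U U00.
rewrite /S mulrC -RintegralZl//.
apply: fine_le; [exact: integrable_fin_num|exact: (integrable_fin_num mT (intZ _ _ intS))|].
apply: ae_ge0_le_integral => //.
- by move=> x _; rewrite lee_fin.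
- exact: measurable_int intG.
- by move=> x _; rewrite lee_fin mulr_ge0.
- exact: measurable_int (intZ (F 0) s intS).
apply: filterS u_ae0 => x /(_ I)/= [ux0] _.
by rewrite lee_fin mulrC (le_trans (gF x))// ux0 mul0r.
Qed.

End Perspective.

(** * Norms as integrals of powers *)

Section Norms.
Context {R : realType} {d : measure_display} {T : measurableType d}.
Variable mu : {measure set T -> \bar R}.

Lemma LpNorm_powR (K : Type) (md : K -> R) (q : R) (f : T -> K) :
  q != 0 -> (forall z, 0 <= md z) ->
  LpNorm mu md q f `^ q = \int[mu]_x (md (f x) `^ q).
Proof.
move=> q0 md0; rewrite /LpNorm -fine_poweR (poweR_Lnorm _ _ q0).
rewrite /Rintegral; congr fine; apply: eq_integral => x _.
by rewrite abse_EFin ger0_norm.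
Qed.

Lemma Lnorm_lty_integrable (h : T -> R) (q : R) : 0 < q ->
  measurable_fun setT h -> (forall x, 0 <= h x) ->
  (Lnorm mu q%:E (fun x => (h x)%:E) < +oo)%E ->
  mu.-integrable setT (EFin \o (fun x => h x `^ q)).
Proof.
move=> q0 mh h0 fin; apply/integrableP; split.
  apply/measurable_EFinP.
  exact: (measurableT_comp (measurable_powR q) mh).
have := poweR_lty q fin; rewrite poweR_Lnorm ?gt_eqF//.
congr (_ < _)%E; apply: eq_integral => x _ /=.
by rewrite !ger0_norm ?powR_ge0.
Qed.

End Norms.

(** * From the numerical inequality to functions *)

Section Transfer.
Context {R : realType} {d : measure_display} {T : measurableType d}.
Variable mu : {measure set T -> \bar R}.
Variables (K : pzRingType) (md : K -> R).
Hypotheses (md_ge0 : forall z, 0 <= md z) (md0 : md 0 = 0)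
  (mdD : forall z w, md (z + w) <= md z + md w)
  (mdM : forall z w, md (z * w) = md z * md w).

Lemma Rintegral_sum (n : nat) (h : 'I_n -> T -> R) :
  (forall j, mu.-integrable setT (EFin \o h j)) ->
  \int[mu]_x (\sum_(j < n) h j x) = \sum_(j < n) \int[mu]_x h j x.
Proof.
move=> inth; rewrite /Rintegral.
under eq_integral do rewrite -sumEFin.
rewrite (integral_sum measurableT inth) -sum_fine// => j _.
exact: integrable_fin_num.
Qed.

Lemma LpNorm_ge0 (q : R) (f : T -> K) : 0 <= LpNorm mu md q f.
Proof. by rewrite fine_ge0// Lnorm_ge0. Qed.

Lemma md_sum_le (n : nat) (z : 'I_n -> K) :
  md (\sum_(j < n) z j) <= \sum_(j < n) md (z j).
Proof.
elim/big_rec2 : _ => [|j y1 y2 _ le12]; first by rewrite md0.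
by rewrite (le_trans (mdD _ _))// lerD2l.
Qed.

Lemma GammaE (n : nat) (p : R) (f : 'I_n -> T -> K) : 0 < p ->
  Gamma mu md p f =
  (n%:R * \int[mu]_x pair_mean n (fun j => md (f j x)) `^ (p / 2)) /
    \sum_(j < n) \int[mu]_x (md (f j x) `^ p).
Proof.
move=> p0; have pn0 : p != 0 by rewrite gt_eqF.
have p2n0 : p / 2 != 0 by rewrite gt_eqF ?divr_gt0.
rewrite /Gamma (LpNorm_powR _ _ _ _ _ p2n0 (@normr_ge0 _ _)).
under eq_bigr do rewrite (LpNorm_powR _ _ _ _ _ pn0 md_ge0).
rewrite invfM invrK mulrA [_ * n%:R]mulrC.
suff -> : (fun x => `|'C(n, 2)%:R^-1 *
      \sum_(j < n) \sum_(k < n | (j < k)%N) md (f j x * f k x)| `^ (p / 2)) =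
    (fun x => pair_mean n (fun j => md (f j x)) `^ (p / 2)) by [].
apply/funext => x; rewrite -[in RHS](ger0_norm (pair_mean_ge0 _ _ _))//.
congr (`|_ * _| `^ _).
by apply: eq_bigr => j _; apply: eq_bigr => k _; exact: mdM.
Qed.

(** Stated for any scalars with a multiplicative absolute value, and any class Lp
    of functions with integrable p-th powers whose sums have measurable absolute
    value, so that it covers R and R[i] at once. *)
Lemma sharp_triangle_of_numerical (Lp : (T -> K) -> Prop) (n : nat) (p : R) :
  2 <= p -> (2 < n)%N ->
  (forall f, Lp f -> measurable_fun setT (fun x => md (f x))) ->
  (forall f, Lp f -> mu.-integrable setT (EFin \o (fun x => md (f x) `^ p))) ->
  (forall f : 'I_n -> T -> K, (forall j, Lp (f j)) ->
    measurable_fun setT (fun x => md (\sum_(j < n) f j x))) ->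
  @numerical_ineq R n p -> sharp_triangle mu md Lp n p.
Proof.
move=> p2 n2 Lpm Lpint Lpsum num f Lpf _.
have p0 : 0 < p by lra.
have N2 := @natr_gt2 R n n2.
pose a x j := md (f j x).
pose s x := \sum_(j < n) a x j `^ p.
pose u x := n%:R * pair_mean n (a x) `^ (p / 2).
pose g x := md (\sum_(j < n) f j x) `^ p.
have us x : 0 <= u x <= s x.
  rewrite mulr_ge0 ?powR_ge0 ?ler0n//=.
  by apply: pair_mean_powR_le => //; [exact: ltnW | lra | move=> j; exact: md_ge0].
have ints : mu.-integrable setT (EFin \o s).
  have := @integrable_sum _ _ _ mu setT measurableT _ (index_enum 'I_n) xpredT
    (fun j x => (a x j `^ p)%:E) (fun j _ => Lpint _ (Lpf j)).
  by congr (integrable _ _ _); apply/funext => x /=; rewrite sumEFin.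
have mu_ : measurable_fun setT u.
  apply: measurable_funM => //.
  apply: (measurableT_comp (measurable_powR (p / 2))).
  apply: measurable_funM => //.
  apply: measurable_sum => i.
  under eq_fun do rewrite big_mkcond/=.
  apply: measurable_sum => j; case: (i < j)%N => //.
  by apply: measurable_funM; exact: Lpm.
have intu : mu.-integrable setT (EFin \o u).
  apply: (le_integrable measurableT _ _ ints).
    exact/measurable_EFinP.
  move=> x _ /=; have /andP[ux usx] := us x.
  by rewrite lee_fin !ger0_norm// (le_trans ux).
have mg : measurable_fun setT g.
  exact: (measurableT_comp (measurable_powR p) (Lpsum _ Lpf)).
pose F := sharp_factor p (n%:R - 1) (beta_exp n p).
have Ng : 0 < n%:R - 1 :> R by lra.
have b0 := @beta_exp_gt0 R n p p2 n2.
have hb : beta_exp n p * (1 + (p - 2) * ((n%:R - 1) / (1 + (n%:R - 1)))) <= 1.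
  have -> : 1 + (n%:R - 1) = n%:R :> R by ring.
  exact: beta_exp_le.
have key : \int[mu]_x g x <= (\int[mu]_x s x) *
    F ((\int[mu]_x u x) / \int[mu]_x s x).
  apply: (Rintegral_perspective_le mu F
    (sharp_factor_deriv p (n%:R - 1) (beta_exp n p))) => //.
  - exact: sharp_factor_le_tangent.
  - exact: powR_ge0.
  - by move=> x; exact: powR_ge0.
  - move=> x; apply: le_trans (numerical_ineq_homogeneous n p (a x) _ num _).
    + apply: (ge0_ler_powR (ltW p0)); rewrite ?nnegrE//.
        by rewrite sumr_ge0// => j _; exact: md_ge0.
      exact: (md_sum_le n (fun j => f j x)).
    + by lra.
    + by move=> j; exact: md_ge0.
have GE : Gamma mu md p f = (\int[mu]_x u x) / \int[mu]_x s x.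
  rewrite GammaE// /s Rintegral_sum; last by move=> j; exact: Lpint.
  congr (_ / _).
  rewrite /u RintegralZl//.
  have := integrableZl measurableT n%:R^-1 intu.
  congr (integrable _ _ _); apply/funext => x.
  by rewrite /= /u -EFinM mulKf// gt_eqF//; lra.
have SE : \sum_(j < n) LpNorm mu md p (f j) `^ p = \int[mu]_x s x.
  rewrite /s Rintegral_sum; last by move=> j; exact: Lpint.
  by apply: eq_bigr => j _; rewrite LpNorm_powR ?gt_eqF.
rewrite SE GE.
have S0 : 0 <= \int[mu]_x s x.
  by apply: Rintegral_ge0 => x _; have /andP[] := us x; exact: le_trans.
have -> : LpNorm mu md p (fun x => \sum_(j < n) f j x) =
    (LpNorm mu md p (fun x => \sum_(j < n) f j x) `^ p) `^ p^-1.
  by rewrite -powRrM divff ?gt_eqF// powRr1 ?LpNorm_ge0.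
rewrite LpNorm_powR ?gt_eqF//.
have -> : (conj_exp p)^-1 = (p - 1) * p^-1 by rewrite /conj_exp invf_div.
rewrite powRrM -powRM ?powR_ge0// mulrC.
apply: ge0_ler_powR; rewrite ?nnegrE ?invr_ge0 ?mulr_ge0 ?powR_ge0 ?(ltW p0)//.
by apply: Rintegral_ge0 => x _; exact: powR_ge0.
Qed.

End Transfer.

(** * From functions to the numerical inequality *)

Section Indicators.
Context {R : realType} {d : measure_display} {T : measurableType d}.
Variable mu : {measure set T -> \bar R}.

Lemma powR_indic (A : set T) (r q : R) (x : T) : 0 <= r -> q != 0 ->
  (r * \1_A x) `^ q = r `^ q * \1_A x.
Proof.
by move=> r0 q0; rewrite indicE; case: (x \in A); rewrite ?mulr1 ?mulr0 ?powR0.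
Qed.

Lemma integrable_indic_lty (A : set T) : measurable A -> (mu A < +oo)%E ->
  mu.-integrable setT (EFin \o (\1_A : T -> R)).
Proof.
move=> mA muA; apply/integrableP; split.
  by apply/measurable_EFinP; exact: measurable_indic.
under eq_integral do rewrite /= ger0_norm//.
by rewrite integral_indic// setIT.
Qed.

Lemma integrable_indicZ (A : set T) (r : R) : measurable A -> (mu A < +oo)%E ->
  mu.-integrable setT (EFin \o (fun x => r * \1_A x)).
Proof.
move=> mA muA.
exact: (integrableZl measurableT r (integrable_indic_lty A mA muA)).
Qed.

Lemma LpNorm_indic (K : Type) (md : K -> R) (A : set T) (q r : R) (h : T -> K) :
  measurable A -> (mu A < +oo)%E -> 0 < q -> (forall z, 0 <= md z) -> 0 <= r ->
  (forall x, md (h x) = r * \1_A x) ->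
  LpNorm mu md q h `^ q = r `^ q * fine (mu A).
Proof.
move=> mA muA q0 md_ge0 r0 hE; have qn0 : q != 0 by rewrite gt_eqF.
rewrite (LpNorm_powR _ _ _ _ _ qn0 md_ge0).
under eq_Rintegral do rewrite hE (powR_indic _ _ _ _ r0 qn0).
rewrite RintegralZl//; last exact: integrable_indic_lty.
by rewrite /Rintegral integral_indic// setIT.
Qed.

End Indicators.

Section Converse.
Context {R : realType} {d : measure_display} {T : measurableType d}.
Variable mu : {measure set T -> \bar R}.
Variables (K : pzRingType) (md : K -> R).
Hypotheses (md_ge0 : forall z, 0 <= md z)
  (mdM : forall z w, md (z * w) = md z * md w).

(** The test functions are the images of a_j 1_A under iota, the inclusion of the
    reals in the scalars. *)
Lemma numerical_of_sharp_triangle (Lp : (T -> K) -> Prop) (n : nat) (p : R)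
    (iota : R -> K) :
  2 <= p -> (0 < n)%N ->
  (exists A : set T, [/\ measurable A, (0 < mu A)%E & (mu A < +oo)%E]) ->
  iota 0 = 0 -> {morph iota : x y / x + y} ->
  (forall r, 0 <= r -> md (iota r) = r) ->
  (forall A r, measurable A -> (mu A < +oo)%E -> 0 <= r ->
    Lp (fun x => iota (r * \1_A x))) ->
  sharp_triangle mu md Lp n p -> @numerical_ineq R n p.
Proof.
move=> p2 n0 [A [mA A0 Aoo]] iota0 iotaD md_iota Lp_indic ST a a0 asum.
have p0 : 0 < p by lra.
have pn0 : p != 0 by rewrite gt_eqF.
pose M := fine (mu A).
have M0 : 0 < M by rewrite fine_gt0 ?A0.
pose f (j : 'I_n) x := iota (a j * \1_A x).
have ind0 x : 0 <= \1_A x :> R by rewrite indicE.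
have mdf j x : md (f j x) = a j * \1_A x by rewrite md_iota// mulr_ge0.
have sum0 : 0 <= \sum_(j < n) a j by rewrite sumr_ge0.
have mdsum x : md (\sum_(j < n) f j x) = (\sum_(j < n) a j) * \1_A x.
  by rewrite -(big_morph iota iotaD iota0) -mulr_suml md_iota// mulr_ge0.
have fn0 : ~ (forall j, {ae mu, forall x, f j x = 0}).
  move=> f0; suff a00 j : a j = 0.
    move: asum; rewrite big1 => [/eqP|j _]; first by rewrite eq_sym oner_eq0.
    by rewrite a00 powR0.
  apply/eqP; apply: contrapT => /negP aj0.
  (* If a_j <> 0, then f_j vanishes nowhere on A, so A would be null. *)
  have [N [mN N0 AN]] := f0 j.
  suff : (mu A <= 0)%E by rewrite leNgt A0.
  rewrite -N0; apply: le_measure; rewrite ?inE//.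
  apply: subset_trans AN => x Ax /= fx0.
  have := mdf j x; rewrite fx0 -iota0 md_iota// indicE mem_set// mulr1 => aj.
  by rewrite -aj eqxx in aj0.
have := ST f (fun j => Lp_indic _ _ mA Aoo (a0 j)) fn0.
have norm_f j : LpNorm mu md p (f j) `^ p = a j `^ p * M.
  exact: (LpNorm_indic mu K md A p (a j)).
have norm_sum : LpNorm mu md p (fun x => \sum_(j < n) f j x) =
    (\sum_(j < n) a j) * M `^ p^-1.
  have Ln0 : 0 <= LpNorm mu md p (fun x => \sum_(j < n) f j x) by exact: LpNorm_ge0.
  rewrite -[LHS](powRr1 Ln0) -(divff pn0) powRrM.
  rewrite (LpNorm_indic mu K md A p (\sum_(j < n) a j))// -/M.
  by rewrite powRM ?powR_ge0 ?(ltW M0)// -powRrM divff// powRr1.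
have sumM : \sum_(j < n) LpNorm mu md p (f j) `^ p = M.
  by under eq_bigr do rewrite norm_f; rewrite -mulr_suml asum mul1r.
have GE : Gamma mu md p f = n%:R * pair_mean n a `^ (p / 2).
  rewrite /Gamma sumM (LpNorm_indic mu R Num.norm A (p / 2) (pair_mean n a))//.
  - have Mn0 : M != 0 by rewrite gt_eqF.
    have nn0 : n%:R != 0 :> R by rewrite pnatr_eq0; lia.
    by rewrite -/M; field; rewrite ?Mn0 ?nn0.
  - by rewrite divr_gt0.
  - exact: pair_mean_ge0.
  move=> x; rewrite ger0_norm.
    rewrite /pair_mean -mulrA; congr (_ * _); rewrite mulr_suml.
    apply: eq_bigr => i _; rewrite mulr_suml; apply: eq_bigr => j _.
    rewrite mdM !mdf indicE; case: (x \in A); rewrite ?mulr1// !mulr0//.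
  rewrite mulr_ge0 ?invr_ge0 ?ler0n// sumr_ge0// => j _.
  by rewrite sumr_ge0.
rewrite norm_sum sumM GE ler_pM2r ?powR_gt0// => h.
have q0 : 0 < conj_exp p by rewrite /conj_exp divr_gt0; lra.
apply: (le_trans (ge0_ler_powR _ _ _ h)); rewrite ?nnegrE ?powR_ge0 ?(ltW q0)//.
rewrite -powRrM mulVf ?gt_eqF// powRr1//.
by rewrite addr_ge0 ?mulr_ge0 ?subr_ge0 ?ler1n ?powR_ge0//; lia.
Qed.

End Converse.

(** * Real and complex scalars *)

Section Instances.
Context {R : realType} {d : measure_display} {T : measurableType d}.
Variable mu : {measure set T -> \bar R}.

Lemma Lnorm_indic_lty (A : set T) (r q : R) : measurable A -> (mu A < +oo)%E ->
  0 < q -> 0 <= r -> (Lnorm mu q%:E (fun x => (r * \1_A x)%:E) < +oo)%E.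
Proof.
move=> mA muA q0 r0; have qn0 : q != 0 by rewrite gt_eqF.
apply: (lty_poweRy qn0); rewrite (poweR_Lnorm _ _ qn0).
have /integrableP[_] := integrable_indicZ mu A (r `^ q) mA muA.
congr (_ < _)%E; apply: eq_integral => x _.
by rewrite /= -(powR_indic _ _ _ _ r0 qn0) !ger0_norm ?powR_ge0// mulr_ge0// indicE.
Qed.

Lemma ReD (z w : R[i]) : complex.Re (z + w) = complex.Re z + complex.Re w.
Proof. by case: z w => [? ?] [? ?]. Qed.

Lemma ImD (z w : R[i]) : complex.Im (z + w) = complex.Im z + complex.Im w.
Proof. by case: z w => [? ?] [? ?]. Qed.

(** As powers are measurable, this form gives [measurable_normc]. *)
Lemma normc_powR (z : R[i]) :
  Normc.normc z = (complex.Re z ^+ 2 + complex.Im z ^+ 2) `^ 2^-1.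
Proof. by case: z => x y /=; rewrite powR12_sqrt// addr_ge0 ?sqr_ge0. Qed.

Lemma normc_ge0 (z : R[i]) : 0 <= Normc.normc z.
Proof. by rewrite normc_powR powR_ge0. Qed.

Lemma measurable_normc (f : T -> R[i]) :
  measurable_fun setT (fun x => complex.Re (f x)) ->
  measurable_fun setT (fun x => complex.Im (f x)) ->
  measurable_fun setT (fun x => Normc.normc (f x)).
Proof.
move=> mRe mIm; under eq_fun do rewrite normc_powR.
apply: (measurableT_comp (measurable_powR 2^-1)).
by apply: measurable_funD; apply: measurable_funX.
Qed.

End Instances.

Theorem theorem1p2 (R : realType) (d : measure_display) (T : measurableType d)
    (mu : {measure set T -> \bar R}) (p : R) (n : nat)
    (hp : 2 <= p) (hn : (2 < n)%N)
    (hmu : exists A : set T,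
      [/\ measurable A, (0 < mu A)%E & (mu A < +oo)%E]) :
  (sharp_triangle_real mu n p <-> numerical_ineq n p) /\
  (sharp_triangle_complex mu n p <-> numerical_ineq n p).
Proof.
have p0 : 0 < p by lra.
have p1 : 1 <= p by lra.
split; split.
- apply: (numerical_of_sharp_triangle mu R Num.norm (@normr_ge0 _ _)
    (@normrM _) _ n p id) => //.
  + exact: ltnW (ltnW hn).
  + exact: ger0_norm.
  + move=> A r mA muA r0; rewrite /Lp_real inE; apply/andP; split.
      by rewrite inE/=; apply: measurable_funM => //; exact: measurable_indic.
    by rewrite inE/=; exact: Lnorm_indic_lty.
- apply: sharp_triangle_of_numerical => //.
  + exact: normr0.
  + exact: ler_normD.
  + exact: normrM.
  + by move=> f; rewrite /Lp_real inE => /andP[/[!inE]/= mf _]; exact: measurableT_comp.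
  + by move=> f; exact: Lfun_integrable.
  + move=> f Lf; apply: measurableT_comp => //; apply: measurable_sum => j.
    by have := Lf j; rewrite /Lp_real inE => /andP[/[!inE]].
- apply: (numerical_of_sharp_triangle mu R[i] (@Normc.normc R) normc_ge0
    (@Normc.normcM R) _ n p (real_complex R)) => //.
  + exact: ltnW (ltnW hn).
  + exact: rmorphD.
  + by move=> r r0; rewrite /= expr0n/= addr0 sqrtr_sqr ger0_norm.
  + move=> A r mA muA r0; split => /=.
    * by apply: measurable_funM => //; exact: measurable_indic.
    * exact: measurable_cst.
    * under eq_Lnorm => x.
        rewrite expr0n/= addr0 sqrtr_sqr ger0_norm; last first.
          by rewrite mulr_ge0// indicE.
        over.
      exact: Lnorm_indic_lty.
- apply: sharp_triangle_of_numerical => //.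
  + exact: normc_ge0.
  + exact: Normc.normc0.
  + exact: le_normcD.
  + exact: Normc.normcM.
  + by move=> f [mRe mIm _]; exact: measurable_normc.
  + move=> f [mRe mIm fin]; apply: Lnorm_lty_integrable => //.
      exact: measurable_normc.
    by move=> x; exact: normc_ge0.
  + move=> f Lf; apply: measurable_normc.
      under eq_fun do rewrite (big_morph _ ReD (erefl : complex.Re (0 : R[i]) = 0)).
      by apply: measurable_sum => j; have [] := Lf j.
    under eq_fun do rewrite (big_morph _ ImD (erefl : complex.Im (0 : R[i]) = 0)).
    by apply: measurable_sum => j; have [] := Lf j.
Qed.
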